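(* Let $K$ be a metric space, $f:K\to\mathbb{R}$ a bounded function, and $\alpha=i_Df$. (a) $\operatorname{osc}_\alpha f(x)=\|f\|_{qD(x)}$ for all $x\in K$. (b) If $f\in D(K)$, there exists a $\varphi\in C_b(K)$ with $\|f\|_{qD}=\|f-\varphi\|_D$.
   Context: For a metric space $X$, $D(X)$ is the set of all $f:X\to\mathbb{C}$ of the form $f=(\varphi_1-\varphi_2)+i(\varphi_3-\varphi_4)$ with $\varphi_1,\dots,\varphi_4$ bounded real-valued lower semi-continuous functions on $X$. Equivalently, $f\in D(X)$ iff there is a sequence $(\varphi_j)$ of continuous complex-valued functions on $X$ with $\sup_{x\in X}\sum_j|\varphi_j(x)|<\infty$ and $f=\sum_j\varphi_j$ pointwise; $\|f\|_{D}=\|f\|_{D(X)}$ is the infimum of $\sup_{x\in X}\sum_j|\varphi_j(x)|$ over all such sequences, and $\|f\|_{D(X)}=\infty$ if $f\notin D(X)$. $C_b(X)$ is the space of bounded continuous complex-valued functions on $X$, and $\|f\|_{qD}=\|f\|_{qD(X)}=\inf_{\varphi\in C_b(X)}\|f-\varphi\|_{D(X)}$ (equal to $\infty$ if $f\notin D(X)$). For $f:K\to\mathbb{C}$ bounded and $x\in K$, $\|f\|_{qD(x)}=\inf\{\|f|U\|_{qD(U)}:U\text{ an open neighborhood of }x\}$. All $\limsup$'s are non-exclusive (the point itself is allowed). For $\varphi:K\to[-\infty,\infty]$, $U\varphi(x)=\limsup_{y\to x}\varphi(y)$ (upper semi-continuous envelope). Transfinite oscillations: $\operatorname{osc}_0f\equiv0$.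 For an ordinal $\beta=\alpha+1$, $\widetilde{\operatorname{osc}}_\beta f(x)=\limsup_{y\to x}\bigl(|f(y)-f(x)|+\operatorname{osc}_\alpha f(y)\bigr)$; for a limit ordinal $\beta$, $\widetilde{\operatorname{osc}}_\beta f=\sup_{\alpha<\beta}\operatorname{osc}_\alpha f$; in both cases $\operatorname{osc}_\beta f=U\,\widetilde{\operatorname{osc}}_\beta f$, with values in $[0,\infty]$. The $D$-index $i_Df$ is the least ordinal $\alpha$ with $\operatorname{osc}_\alpha f=\operatorname{osc}_{\alpha+1}f$ (such an ordinal exists). *)

(* Defs.v *)
(* MathComp-Analysis. *)
From HB Require Import structures.
From mathcomp Require Import all_boot all_order all_algebra.
From mathcomp Require Import all_classical all_reals all_analysis.
From mathcomp Require Import complex.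

Set Implicit Arguments.
Unset Strict Implicit.
Unset Printing Implicit Defensive.

Import Order.TTheory GRing.Theory Num.Theory.
Import numFieldNormedType.Exports.
Import Normc.

Local Open Scope classical_set_scope.
Local Open Scope ring_scope.
Local Open Scope complex_scope.

(* Ordinals are represented by well-ordered types, so that each ordinal has
   many (isomorphic) representatives. *)

Record ordnum := OrdNum {
  ordnum_sort :> Type ;
  olt : ordnum_sort -> ordnum_sort -> Prop ;
  olt_trans : forall u v w, olt u v -> olt v w -> olt u w ;
  olt_total : forall v w, olt v w \/ v = w \/ olt w v ;
  olt_wf : well_founded olt }.

(* a is isomorphic to an initial segment of b *)
Definition ordnum_le (a b : ordnum) : Prop :=
  exists h : a -> b,
    (forall v w, olt v w -> olt (h v) (h w)) /\
    (forall v z, olt z (h v) -> exists w, h w = z).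

Definition olt0 (v w : False) : Prop := False.

Lemma olt0_trans u v w : olt0 u v -> olt0 v w -> olt0 u w.
Proof. by []. Qed.

Lemma olt0_total v w : olt0 v w \/ v = w \/ olt0 w v.
Proof. by case: v. Qed.

Lemma olt0_wf : well_founded olt0.
Proof. by case. Qed.

Definition ordnum0 : ordnum := OrdNum olt0_trans olt0_total olt0_wf.

Section ordnum_succ.
Context (a : ordnum).

(* None is the new top element of a + 1 *)
Definition oltS (v w : option a) : Prop :=
  match v, w with
  | Some v', Some w' => olt v' w'
  | Some _, None => True
  | None, _ => False
  end.

Lemma oltS_trans u v w : oltS u v -> oltS v w -> oltS u w.
Proof. by case: u v w => [u|] [v|] [w|] //=; exact: olt_trans. Qed.

Lemma oltS_total v w : oltS v w \/ v = w \/ oltS w v.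
Proof.
case: v w => [v|] [w|] /=; [|by left|by right; right|by right; left].
by have [?|[->|?]] := olt_total v w; [left|right; left|right; right].
Qed.

Lemma oltS_wf : well_founded oltS.
Proof.
have wfS v : Acc oltS (Some v).
  by elim/(well_founded_ind (@olt_wf a)): v => v IH; split => -[w|//] /IH.
by move=> [//|]; split => -[].
Qed.

Definition ordnum_succ : ordnum := OrdNum oltS_trans oltS_total oltS_wf.

End ordnum_succ.

Definition opred (W : ordnum) (v w : W) : Prop :=
  olt v w /\ forall u, olt u w -> ~ olt v u.

Section oscillation.
Context {R : realType} {K : metricType R}.
Implicit Types (f : K -> R[i]) (phi g : K -> \bar R) (x y : K).
Local Open Scope ereal_scope.

(* nbhs x is not punctured, so this limsup is non-exclusive *)
Definition usc_env phi x : \bar R := limf_esup phi (nbhs x).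

Definition osc_tilde_succ f g x : \bar R :=
  limf_esup (fun y => (normc (f y - f x)%R)%:E + g y) (nbhs x).

Definition osc_rec f (W : ordnum) (w : W)
    (rec : forall v : W, olt v w -> K -> \bar R) : K -> \bar R :=
  match pselect (exists v, opred v w) with
  | left ex => let v := cid ex in
      usc_env (osc_tilde_succ f (rec (sval v) (svalP v).1))
  | right _ =>
      if pselect (exists v, olt v w) then
        usc_env (fun x =>
          ereal_sup [set t | exists v (vw : olt v w), t = rec v vw x])
      else fun=> 0
  end.

(* The oscillation of f indexed by the order type of {v : W | v < w} *)
Definition osc_at f (W : ordnum) (w : W) : K -> \bar R :=
  Fix (@olt_wf W) (fun=> K -> \bar R) (@osc_rec f W) w.

Definition osc f (a : ordnum) : K -> \bar R :=
  @osc_at f (ordnum_succ a) None.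

Lemma osc_atE f (W : ordnum) (w : W) :
  osc_at f w = osc_rec f (fun (v : W) (_ : olt v w) => osc_at f v).
Proof.
rewrite /osc_at Fix_eq// => v g h gh; congr osc_rec.
by apply: functional_extensionality_dep => u; apply/funext => uv; exact: gh.
Qed.

Lemma osc_at_zero f (W : ordnum) (w : W) :
  (forall v, ~ olt v w) -> osc_at f w = fun=> 0.
Proof.
move=> w0; rewrite osc_atE /osc_rec.
case: pselect => [ex|_]; first by exfalso; case: ex => v [/w0].
by case: pselect => [ex|//]; exfalso; case: ex => v /w0.
Qed.

Lemma osc_at_succ f (W : ordnum) (v w : W) : opred v w ->
  osc_at f w = usc_env (osc_tilde_succ f (osc_at f v)).
Proof.
move=> vw; rewrite osc_atE /osc_rec; case: pselect => [ex|[]]; last by exists v.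
case: (cid ex) => u [uw uw'] /=; suff -> : u = v by [].
have [uv|[//|vu]] := olt_total u v; first by case: (uw' v vw.1).
by case: (vw.2 u uw).
Qed.

Lemma osc_at_limit f (W : ordnum) (w : W) :
  (exists v, olt v w) -> (forall v, ~ opred v w) ->
  osc_at f w =
  usc_env (fun x => ereal_sup [set osc_at f v x | v in [set v | olt v w]]).
Proof.
move=> exw wl; rewrite osc_atE /osc_rec.
case: pselect => [ex|_]; first by exfalso; case: ex => v /wl.
case: pselect => [ne|//].
congr usc_env; apply/funext => x; congr ereal_sup; apply/seteqP; split=> t /=.
  by move=> [v [vw ->]]; exists v.
by move=> [v vw <-]; exists v, vw.
Qed.

Definition is_D_index f (a : ordnum) : Prop :=
  osc f a = osc f (ordnum_succ a) /\
  forall b, osc f b = osc f (ordnum_succ b) -> ordnum_le a b.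

(* Such an ordinal always exists, so the default value is never used. *)
Definition D_index f : ordnum :=
  match pselect (exists a, is_D_index f a) with
  | left ex => sval (cid ex)
  | right _ => ordnum0
  end.

End oscillation.

(* R[i] carries its usual topology and norm under the alias R[i]^o.
   In this section a subset A of K is regarded as a metric space in its own
   right and a function on A as the restriction of a function on K: the notions
   relative to A below depend only on the restrictions to A. *)
Section D_norm.
Context {R : realType} {K : metricType R}.
Implicit Types (f phi : K -> R[i]) (A : set K).

Definition in_D f : Prop :=
  exists phi1 phi2 phi3 phi4 : K -> R,
    [/\ [/\ bounded_fun phi1, bounded_fun phi2,
            bounded_fun phi3 & bounded_fun phi4],
        [/\ lower_semicontinuous (EFin \o phi1),
            lower_semicontinuous (EFin \o phi2),
            lower_semicontinuous (EFin \o phi3) &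
            lower_semicontinuous (EFin \o phi4)] &
        forall x, f x = (phi1 x - phi2 x)%:C + 'i%C * (phi3 x - phi4 x)%:C].

(* The maximum with 0 only matters for A = set0: the supremum is taken
   in [0, +oo]. *)
Definition sup_sum_norm A (phi : nat -> K -> R[i]) : \bar R :=
  maxe 0%E (ereal_sup [set (\sum_(0 <= j <oo) (normc (phi j x))%:E)%E | x in A]).

Definition D_representation A f (phi : nat -> K -> R[i]) : Prop :=
  [/\ forall j, {within A, continuous (phi j : K -> R[i]^o)},
      (sup_sum_norm A phi < +oo)%E &
      forall x, A x ->
        (series (phi ^~ x) : nat -> R[i]^o) @ \oo --> (f x : R[i]^o)].

(* +oo when the restriction of f to A is not in D(A) *)
Definition D_norm A f : \bar R :=
  ereal_inf [set sup_sum_norm A phi | phi in D_representation A f].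

Definition C_b A : set (K -> R[i]) :=
  [set phi | {within A, continuous (phi : K -> R[i]^o)} /\
             [bounded (phi x : R[i]^o) | x in A]].

Definition qD_norm A f : \bar R :=
  ereal_inf [set D_norm A (f \- phi) | phi in C_b A].

Definition qD_norm_at f (x : K) : \bar R :=
  ereal_inf [set qD_norm U f | U in [set U | open U /\ U x]].

End D_norm.

(* Main.v *)
(* The oscillation osc_alpha f at the D-index alpha is the least h : K -> [0, +oo]
   such that limsup_{y -> x} (|f y - f x| + h y) <= h x for all x, that is, such
   that h, h + f and h - f are upper semicontinuous. If f - phi = sum_j phi_j on
   an open set U with sum_j |phi_j| <= M, then M - sum_j |phi_j| is such an h on
   U, hence osc_alpha f <= M there. Conversely, if osc_alpha f <= lam on U, then
   s = lam - osc_alpha f makes f - s upper and f + s lower semicontinuous; a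
   continuous phi inserted between them satisfies |f - phi| <= s, and f - phi is
   the difference of the nonnegative lower semicontinuous functions
   (s + (f - phi)) / 2 and (s - (f - phi)) / 2, which sum to s <= lam. Both
   parts follow, the second with U = K and lam = sup osc_alpha f. *)
Require Import Defs.
From HB Require Import structures.
From mathcomp Require Import all_boot all_order all_algebra.
From mathcomp Require Import all_classical all_reals all_analysis.
From mathcomp Require Import complex.
From mathcomp Require Import wochoice ring lra.

Set Implicit Arguments.
Unset Strict Implicit.
Unset Printing Implicit Defensive.

Import Order.TTheory GRing.Theory Num.Theory.
Import numFieldNormedType.Exports.
Import Normc.

Local Open Scope classical_set_scope.
Local Open Scope ring_scope.
Local Open Scope complex_scope.

Lemma normc_ge0 (R : rcfType) (z : R[i]) : 0 <= normc z.
Proof. by case: z => a b; exact: sqrtr_ge0. Qed.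

(** * Well-orders too long to inject into a given type *)

Lemma not_injective_set (T : Type) (h : set T -> T) :
  exists A B, A <> B /\ h A = h B.
Proof.
(* Cantor's diagonal: [D] collects the images of sets that do not contain their own image, and
   injectivity would make [h D] both in and out of [D]. *)
apply: contrapT => nex; pose D := [set t | exists A, h A = t /\ ~ A t].
have hD A : h A = h D -> A = D.
  by move=> hA; apply: contrapT => AD; apply: nex; exists A, D.
have nD : ~ D (h D) by move=> [A [/hD ->]] nDh; apply: (nDh); exists D.
by apply: (nD); exists D.
Qed.

(** Zermelo's theorem well-orders [set T], which by the diagonal argument is too large to inject
    into [T]. *)
Lemma ordnum_large (T : Type) :
  exists W : ordnum, forall h : W -> T, exists v w, olt v w /\ h v = h w.
Proof.
have [Rle wo] := well_ordering_principle {classic set T}.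
(* [wo] only provides a unique least element of each nonempty predicate; applied to pairs and
   triples it yields totality, antisymmetry and transitivity. *)
have Rtot : total Rle.
  move=> x y; have [|z [[/orP[]/eqP-> zP] _]] := wo (pred2 x y).
  - by exists x; rewrite !inE eqxx.
  - by rewrite zP// !inE eqxx orbT.
  - by rewrite (zP x) ?orbT// !inE eqxx.
have Rxx x : Rle x x by have := Rtot x x; rewrite orbb.
have Ranti : antisymmetric Rle.
  move=> x y /andP[xy yx].
  have [|z [_ zP]] := wo (pred2 x y); first by exists x; rewrite !inE eqxx.
  by apply: (etrans (esym (zP x _)) (zP y _)); split; rewrite ?inE ?eqxx ?orbT// => t;
    rewrite !inE => /orP[]/eqP->.
pose lt x y := Rle x y /\ x <> y.
have lt_trans x y z : lt x y -> lt y z -> lt x z.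
  move=> [xy nxy] [yz nyz].
  have [|t [[t3 tP] _]] := wo (pred3 x y z); first by exists x; rewrite !inE eqxx.
  have [tx ty tz] : [/\ Rle t x, Rle t y & Rle t z].
    by split; apply: tP; rewrite !inE eqxx ?orbT.
  case/or3P: t3 => /eqP tE; subst t; first split => //.
  - by move=> xz; subst z; apply: nxy; apply: Ranti; rewrite xy.
  - by exfalso; apply: nxy; apply: Ranti; rewrite xy.
  - by exfalso; apply: nyz; apply: Ranti; rewrite yz.
have lt_total x y : lt x y \/ x = y \/ lt y x.
  have [->|/eqP xy] := eqVneq x y; first by right; left.
  by have [xy'|yx] := orP (Rtot x y); [left|right; right; split => // /esym].
have lt_wf : well_founded lt.
  move=> x; apply: contrapT => nacc.
  have [|z [[/asboolP nz zP] _]] := wo [pred z | `[< ~ Acc lt z >]].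
    by exists x; apply/asboolP.
  apply: nz; split => y [yz nyz]; apply: contrapT => ny; apply: nyz.
  by apply: Ranti; rewrite yz zP//; apply/asboolP.
exists (OrdNum lt_trans lt_total lt_wf) => h /=.
have [A [B [AB hAB]]] := not_injective_set h.
by have [?|[//|?]] := lt_total A B; [exists A, B|exists B, A].
Qed.

(** * Limsups and upper semicontinuous envelopes *)

Section limf_esup_lemmas.
Context {R : realType} {T : choiceType} {X : filteredType T}.
Implicit Types (phi psi : X -> \bar R) (F : set_system X).
Local Open Scope ereal_scope.

Lemma limf_esup_le phi F c :
  (\forall y \near F, phi y <= c) -> limf_esup phi F <= c.
Proof.
move=> Fc; rewrite limf_esupE; apply: ge_ereal_inf.
by eexists; [eexists; [exact: Fc|reflexivity]|apply: ub_ereal_sup => _ [y ? <-]].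
Qed.

Lemma limf_esup_lt phi F {FF : Filter F} c :
  limf_esup phi F < c -> \forall y \near F, phi y < c.
Proof.
rewrite limf_esupE => /ereal_inf_lt[_ [V FV <-] Vc].
apply: filterS FV => y Vy; apply: le_lt_trans Vc.
by apply: ereal_sup_ubound; exists y.
Qed.

Lemma le_limf_esup phi psi F {FF : Filter F} :
  (\forall y \near F, phi y <= psi y) -> limf_esup phi F <= limf_esup psi F.
Proof.
move=> Fle; rewrite [leRHS]limf_esupE; apply: le_ereal_inf_tmp => _ [V FV <-].
apply: limf_esup_le; apply: filterS2 FV Fle => y Vy /le_trans; apply.
by apply: ereal_sup_ubound; exists y.
Qed.

End limf_esup_lemmas.

Section upper_envelope.
Context {R : realType} {K : metricType R}.
Implicit Types (phi psi g h : K -> \bar R) (x y : K) (f : K -> R[i]).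
Local Open Scope ereal_scope.

Lemma limf_esup_nbhs_ge phi x : phi x <= limf_esup phi (nbhs x).
Proof.
rewrite limf_esupE; apply: le_ereal_inf_tmp => _ [V Vx <-].
by apply: ereal_sup_ubound; exists x => //; exact: nbhs_singleton.
Qed.

Lemma usc_env_ge phi x : phi x <= usc_env phi x.
Proof. exact: limf_esup_nbhs_ge. Qed.

Lemma le_usc_env phi psi : (forall x, phi x <= psi x) ->
  forall x, usc_env phi x <= usc_env psi x.
Proof. by move=> le x; apply: le_limf_esup; apply: nearW. Qed.

Lemma usc_envK phi : usc_env (usc_env phi) = usc_env phi.
Proof.
apply/funext => x; apply/eqP; rewrite eq_le usc_env_ge andbT.
rewrite [leRHS]limf_esupE; apply: le_ereal_inf_tmp => _ [V Vx <-].
apply: limf_esup_le; apply: filterS (nbhs_interior Vx) => y Vy.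
by apply: limf_esup_le; apply: filterS Vy => z Vz; apply: ereal_sup_ubound; exists z.
Qed.

Definition osc_step f g : K -> \bar R := usc_env (osc_tilde_succ f g).

Lemma le_osc_tilde_succ f g h : (forall x, g x <= h x) ->
  forall x, osc_tilde_succ f g x <= osc_tilde_succ f h x.
Proof. by move=> le x; apply: le_limf_esup; apply: nearW => y; exact: leeD2l. Qed.

Lemma le_osc_step f g h : (forall x, g x <= h x) ->
  forall x, osc_step f g x <= osc_step f h x.
Proof. by move=> le; apply: le_usc_env; exact: le_osc_tilde_succ. Qed.

Lemma osc_tilde_succ_ge f g x : g x <= osc_tilde_succ f g x.
Proof.
apply: le_trans (limf_esup_nbhs_ge _ x).
by rewrite subrr normc0 add0e.
Qed.

Lemma osc_step_ge f g x : g x <= osc_step f g x.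
Proof. exact: le_trans (osc_tilde_succ_ge f g x) (usc_env_ge _ _). Qed.

End upper_envelope.

(** * Transfinite oscillations and the existence of the index *)

Section osc_at_theory.
Context {R : realType} {K : metricType R}.
Variable f : K -> R[i].
Implicit Types (h : K -> \bar R) (x y : K).
Local Open Scope ereal_scope.

Section one_ordinal.
Variable W : ordnum.
Implicit Types v w : W.

Lemma osc_atP w :
  [\/ (forall v, ~ olt v w) /\ osc_at f w = cst 0,
      exists2 v, opred v w & osc_at f w = osc_step f (osc_at f v) |
      [/\ exists v, olt v w, forall v, ~ opred v w & osc_at f w =
         usc_env (fun x => ereal_sup [set osc_at f v x | v in [set v | olt v w]])]].
Proof.
case: (pselect (exists v, opred v w)) => [[v vw]|/forallNP nopred].
  by constructor 2; exists v => //; exact: osc_at_succ.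
case: (pselect (exists v, olt v w)) => [exw|/forallNP now].
  by constructor 3; split => //; exact: osc_at_limit.
by constructor 1; split => //; exact: osc_at_zero.
Qed.

Lemma osc_at_ge0 w x : 0 <= osc_at f w x.
Proof.
elim/(well_founded_ind (@olt_wf W)): w x => w IH x.
case: (osc_atP w) => [[_ ->]//|[v [vw _] ->]|[[v vw] _ ->]].
  exact: le_trans (IH v vw x) (osc_step_ge _ _ _).
apply: le_trans (IH v vw x) (le_trans _ (usc_env_ge _ _)).
by apply: ereal_sup_ubound; exists v.
Qed.

Lemma usc_env_osc_at w : usc_env (osc_at f w) = osc_at f w.
Proof.
case: (osc_atP w) => [[_ w0]|[v _ ->]|[_ _ ->]]; [|exact: usc_envK..].
apply/funext => x; apply/eqP; rewrite eq_le usc_env_ge andbT w0.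
by apply: limf_esup_le; exact: nearW.
Qed.

(** The successor case passes through the predecessor, the limit case through some [u] strictly
    between [v] and [w]. As a step never decreases a function, monotonicity in the index is
    included. *)
Lemma osc_step_osc_at_le v w : olt v w ->
  forall x, osc_step f (osc_at f v) x <= osc_at f w x.
Proof.
elim/(well_founded_ind (@olt_wf W)): w v => w IH v vw x.
case: (osc_atP w) => [[/(_ v)//]|[u [uw uw'] ->]|[_ nopred ->]].
- case: (olt_total u v) => [/(uw' _ vw)//|[->//|vu]].
  exact: le_trans (IH u uw v vu x) (osc_step_ge _ _ _).
- have [u vu uw] : exists2 u, olt v u & olt u w.
    apply: contrapT => nou; apply: (nopred v); split => // u uw vu.
    by apply: nou; exists u.
  apply: le_trans (IH u uw v vu x) (le_trans _ (usc_env_ge _ _)).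
  by apply: ereal_sup_ubound; exists u.
Qed.

(** One formula for the zero, successor and limit cases: only the set of values below [w] matters,
    so stages of different well-orders become comparable. The adjoined 0 serves the least
    element. *)
Lemma osc_at_sup w : osc_at f w = usc_env (fun x =>
  ereal_sup (0 |` [set osc_step f (osc_at f v) x | v in [set v | olt v w]])).
Proof.
apply/funext => x; apply/eqP; rewrite eq_le; apply/andP; split.
- case: (osc_atP w) => [[_ ->]|[u [uw _] ->]|[_ _ ->]].
  + apply: le_trans (usc_env_ge _ _).
    by apply: ereal_sup_ubound; left.
  + apply: le_trans (usc_env_ge _ _).
    by apply: ereal_sup_ubound; right; exists u.
  + apply: le_usc_env => y; apply: ub_ereal_sup => _ [v vw <-].
    apply: le_trans (osc_step_ge f _ _) _.
    by apply: ereal_sup_ubound; right; exists v.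
- rewrite -[leRHS]/(osc_at f w x) -[in leRHS]usc_env_osc_at.
  apply: le_usc_env => y; apply: ub_ereal_sup => _ [->|[v vw <-]].
    exact: osc_at_ge0.
  exact: osc_step_osc_at_le.
Qed.

(** A step is monotone and takes [h] to something below [h], so by induction no stage rises above
    [h]. *)
Lemma osc_at_le h w : (forall x, 0 <= h x) ->
  (forall x, osc_tilde_succ f h x <= h x) -> forall x, osc_at f w x <= h x.
Proof.
move=> h0 hP.
(* [h] is upper semicontinuous, because the term with [normc] only raises the limsup. *)
have usch x : usc_env h x <= h x.
  apply: le_trans (hP x); apply: le_limf_esup; apply: nearW => y.
  by rewrite leeDr// lee_fin normc_ge0.
elim/(well_founded_ind (@olt_wf W)): w => w IH x.
rewrite osc_at_sup; apply: (le_trans _ (usch x)); apply: le_usc_env => y.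
apply: ub_ereal_sup => _ [->//|[v vw <-]].
apply: le_trans (le_osc_step f (IH v vw) y) _.
by rewrite /osc_step; exact: le_trans (le_usc_env hP y) (usch y).
Qed.

End one_ordinal.

(* Two elements are related by a bisimulation exactly when the initial
   segments below them are isomorphic. *)
Definition bisimulation (V W : ordnum) (P : V -> W -> Prop) :=
  forall v w, P v w ->
    (forall u, olt u v -> exists2 z, olt z w & P u z) /\
    (forall z, olt z w -> exists2 u, olt u v & P u z).

Lemma bisimulation_osc_at (V W : ordnum) (P : V -> W -> Prop) v w :
  bisimulation P -> P v w -> osc_at f v = osc_at f w.
Proof.
move=> bP; elim/(well_founded_ind (@olt_wf V)): v w => v IH w Pvw.
rewrite !osc_at_sup; congr usc_env; apply/funext => x.
congr (ereal_sup (_ `|` _)); have [vw wv] := bP _ _ Pvw.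
apply/seteqP; split => _ [u /= uP <-].
  by have [z zw Puz] := vw _ uP; exists z => //=; rewrite (IH _ uP _ Puz).
by have [z zv Pzu] := wv _ uP; exists z => //=; rewrite (IH _ zv _ Pzu).
Qed.

(** Infinite descent in [W]: if [u] and a larger [v] are both related to [w], then [u] is related to
    some [z] below [w], and some [t] below [u] is related to the same [z]. *)
Lemma bisimulation_inj (V W : ordnum) (P : V -> W -> Prop) u v w :
  bisimulation P -> P u w -> P v w -> u = v.
Proof.
move=> bP Pu Pv.
suff nlt w' : forall u' v', P u' w' -> P v' w' -> ~ olt u' v'.
  by have [/(nlt w _ _ Pu Pv)//|[//|/(nlt w _ _ Pv Pu)]] := olt_total u v.
elim/(well_founded_ind (@olt_wf W)): w' => {}w IH {Pu Pv}u {}v Pu Pv uv.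
have [z zw Puz] := (bP _ _ Pv).1 u uv.
have [t tu Ptz] := (bP _ _ Pu).2 z zw.
exact: IH zw _ _ Ptz Puz tu.
Qed.

Lemma bisimulation_sym (V W : ordnum) (P : V -> W -> Prop) :
  bisimulation P -> bisimulation (fun w v => P v w).
Proof. by move=> bP w v /bP[]. Qed.

Lemma bisimulation_fun (V W : ordnum) (P : V -> W -> Prop) v w z :
  bisimulation P -> P v w -> P v z -> w = z.
Proof. by move/bisimulation_sym/bisimulation_inj; exact. Qed.

Definition bisimilar (V W : ordnum) (v : V) (w : W) :=
  exists2 P : V -> W -> Prop, bisimulation P & P v w.

Lemma bisimulation_bisimilar (V W : ordnum) : bisimulation (@bisimilar V W).
Proof.
move=> v w [P bP /bP[vw wv]]; split => [u /vw|z /wv] [t ? ?];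
  by exists t => //; exists P.
Qed.

Lemma ordnum_compare (V W : ordnum) :
  (forall v : V, exists w : W, bisimilar v w) \/
  (forall w : W, exists v : V, bisimilar v w).
Proof.
have least (U : ordnum) (Q : U -> Prop) : ~ (forall u, Q u) ->
    exists2 u, ~ Q u & forall v, olt v u -> Q v.
  move=> nQ; apply: contrapT => nex; apply: nQ => u.
  elim/(well_founded_ind (@olt_wf U)): u => u IH.
  by apply: contrapT => nQu; apply: nex; exists u.
(* Take the least unmatched [v] and [w]. Elements below either one are matched below the other, so
   [bisimilar] extended by the pair is again a bisimulation, which matches [v] after all. *)
apply: contrapT => /not_orP[/least[v nv vP] /least[w nw wP]].
have vw u : olt u v -> exists2 z, olt z w & bisimilar u z.
  move=> uv; have [z uz] := vP u uv; exists z => //.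
  have [//|[zw|wz]] := olt_total z w; first by exfalso; apply: nw; exists u; rewrite -zw.
  by have [t _ tw] := (bisimulation_bisimilar uz).2 w wz; exfalso; apply: nw; exists t.
have wv z : olt z w -> exists2 u, olt u v & bisimilar u z.
  move=> zw; have [u uz] := wP z zw; exists u => //.
  have [//|[uv|vu]] := olt_total u v; first by exfalso; apply: nv; exists z; rewrite -uv.
  by have [t _ vt] := (bisimulation_bisimilar uz).1 v vu; exfalso; apply: nv; exists t.
apply: nv; exists w; exists (fun u z => bisimilar u z \/ (u = v /\ z = w)); last by right.
move=> u z [/bisimulation_bisimilar[uz zu]|[-> ->]].
  split=> [t /uz|t /zu] [s]; exists s => //; by left.
split=> [t /vw|t /wv] [s]; exists s => //; by left.
Qed.

Lemma ordnum_le_bisimilar (V W : ordnum) :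
  (forall v : V, exists w : W, bisimilar v w) -> ordnum_le V W.
Proof.
move=> /choice[h hP]; have bE := @bisimulation_bisimilar V W; exists h; split.
  move=> u v uv; have [z zv uz] := (bE _ _ (hP v)).1 u uv.
  by rewrite (bisimulation_fun bE (hP u) uz).
move=> v z zv; have [u uv uz] := (bE _ _ (hP v)).2 z zv.
by exists u; rewrite (bisimulation_fun bE (hP u) uz).
Qed.

Lemma osc_succE (a : ordnum) : osc f (ordnum_succ a) = osc_step f (osc f a).
Proof.
rewrite /osc (@osc_at_succ _ _ f (ordnum_succ (ordnum_succ a)) (Some None)) => [|]; last first.
  by split => // -[[u|]|] /= // _ [].
rewrite -/(osc_step _ _); congr osc_step.
(* [Some None], the predecessor of the top, corresponds to the top of [ordnum_succ a], where
   [osc f a] is read off. *)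
pose P (v : ordnum_succ (ordnum_succ a)) (w : ordnum_succ a) := v = Some w.
apply: (@bisimulation_osc_at _ _ P) => // v w ->; split => [[u|]//= uw|z zw].
  by exists u.
by exists (Some z).
Qed.

Section initial_segment.
Variables (W : ordnum) (w : W).

Definition seg : Type := {v : W | olt v w}.
Definition olt_seg (u v : seg) := olt (sval u) (sval v).

Lemma olt_seg_trans u v z : olt_seg u v -> olt_seg v z -> olt_seg u z.
Proof. exact: olt_trans. Qed.

Lemma olt_seg_total u v : olt_seg u v \/ u = v \/ olt_seg v u.
Proof.
have [uv|[uv|vu]] := olt_total (sval u) (sval v); [by left|right; left|by right; right].
by case: u v uv => [u up] [v vp] /= uv; subst v; congr exist; exact: Prop_irrelevance.
Qed.

Lemma olt_seg_wf : well_founded olt_seg.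
Proof.
suff acc (x : W) : forall v : seg, sval v = x -> Acc olt_seg v by move=> v; exact: acc.
elim/(well_founded_ind (@olt_wf W)): x => x IH v vx.
by split => u uv; apply: (IH (sval u)) => //; rewrite -vx.
Qed.

(** The ordinal that the element [w] stands for: it turns a stage inside [W] into an index of
    [osc]. *)
Definition ordnum_seg : ordnum := OrdNum olt_seg_trans olt_seg_total olt_seg_wf.

Lemma osc_at_seg (v : ordnum_seg) : osc_at f v = osc_at f (sval v).
Proof.
apply: (@bisimulation_osc_at _ _ (fun (v : ordnum_seg) (z : W) => z = sval v)) => //.
move=> {}v _ ->; split => [u uv|z zv]; first by exists (sval u).
by exists (exist _ z (olt_trans zv (svalP v))).
Qed.

Lemma osc_seg : osc f ordnum_seg = osc_at f w.
Proof.
pose P (v : ordnum_succ ordnum_seg) (x : W) :=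
  if v is Some v' then x = sval v' else x = w.
apply: (@bisimulation_osc_at _ _ P) => // -[v|] _ ->; split => [[u|]//= uv|z zv].
- by exists (sval u).
- by exists (Some (exist _ z (olt_trans zv (svalP v)))).
- by exists (sval u) => //; exact: (svalP u).
- by exists (Some (exist _ z zv)).
Qed.

End initial_segment.

(** On a long enough [W] the stages repeat a value, at [v0] and a later [w0]. Monotonicity squeezes
    the step at [v0] between them, so [v0] is fixed, and the least fixed stage gives the index. *)
Lemma D_index_exists : exists a, is_D_index f a.
Proof.
have [W /(_ (@osc_at _ _ f W))[v0 [w0 [vw0 eq0]]]] := ordnum_large (K -> \bar R).
pose fixed (v : W) := osc_step f (osc_at f v) = osc_at f v.
have fix0 : fixed v0.
  apply/funext => x; apply/eqP; rewrite eq_le osc_step_ge andbT [in leRHS]eq0.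
  exact: osc_step_osc_at_le.
have [w fixw minw] : exists2 w, fixed w & forall v, olt v w -> ~ fixed v.
  apply: contrapT => nex; move: fix0.
  elim/(well_founded_ind (@olt_wf W)): v0 {vw0 eq0} => v IH fv.
  by apply: nex; exists v => // u /IH.
exists (ordnum_seg w); split => [|b]; first by rewrite osc_succE osc_seg fixw.
rewrite osc_succE => /esym fixb.
(* A match of [v] with the top of [b + 1] would transport the fixed stage of [b] to [v], below the
   least fixed [w]. Hence [b + 1] cannot be exhausted inside the segment, and the segment embeds
   into [b]. *)
have nomatch (v : ordnum_seg w) : ~ bisimilar v (None : ordnum_succ b).
  move=> [P bP Pv]; apply: (minw _ (svalP v)).
  by rewrite /fixed -osc_at_seg (bisimulation_osc_at bP Pv).
case: (ordnum_compare (ordnum_seg w) (ordnum_succ b)) => [cmp|/(_ None)[v /nomatch//]].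
apply: ordnum_le_bisimilar => v; case: (cmp v) => -[z|/nomatch//] [P bP Pvz].
exists z; exists (fun u t => P u (Some t)) => // u t /bP[ut tu]; split.
  move=> s su; have [[s'|//] s't Pss'] := ut s su; by exists s'.
by move=> s st; have [s' ? ?] := tu (Some s) st; exists s'.
Qed.

(** Extracts the three facts through which the oscillation enters all that follows: positivity, the
    fixed-point inequality and minimality. *)
Lemma osc_D_index : let g := osc f (D_index f) in
  [/\ forall x, 0 <= g x, forall x, osc_tilde_succ f g x <= g x &
      forall h, (forall x, 0 <= h x) ->
        (forall x, osc_tilde_succ f h x <= h x) -> forall x, g x <= h x].
Proof.
move=> g; have [gE _] : is_D_index f (D_index f).
  rewrite /D_index; case: pselect => [ex|/(_ D_index_exists)//].
  by case: (cid ex).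
split => [x|x|h h0 hP x]; [exact: osc_at_ge0| |exact: osc_at_le].
by rewrite [leRHS](congr1 (@^~ x) gE) osc_succE usc_env_ge.
Qed.

End osc_at_theory.

(** * Semicontinuous functions: monotone approximation and insertion *)

Section semicontinuity.
Context {R : realType} {K : metricType R}.
Implicit Types (A : set K) (u p q phi : K -> R) (x y z : K).

(** Neighborhoods are those of [K]; for open [A] this is lower semicontinuity of the restriction to
    [A]. *)
Definition lsc_on A u := forall x, A x -> forall e, 0 < e ->
  \forall y \near x, u x - e < u y.

Lemma lsc_on_scale A u (r : R) : 0 < r -> lsc_on A u ->
  lsc_on A (fun x => r * u x).
Proof.
move=> r0 lu x Ax e e0; have := lu x Ax (e / r) (divr_gt0 e0 r0).
apply: filterS => y uy.
by rewrite -subr_gt0 -(mulr0 r) (_ : _ - _ = r * (u y - (u x - e / r)));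
  [rewrite ltr_pM2l ?subr_gt0|field; exact: lt0r_neq0].
Qed.

Lemma lsc_on_addr_continuous A u p : lsc_on A u ->
  (forall x, A x -> {for x, continuous p}) -> lsc_on A (fun x => u x + p x).
Proof.
move=> lu cp x Ax e e0; have e2 : 0 < e / 2 by rewrite divr_gt0.
near=> y.
have uy : u x - e / 2 < u y by near: y; exact: lu.
have py : p x - e / 2 < p y.
  near: y; apply: (cvgr_gt (p x)); first exact: cp.
  by rewrite ltrBlDr ltrDl.
by lra.
Unshelve. all: by end_near. Qed.

(* The approximants are the inf-convolutions of u with n times the distance. *)
Lemma lsc_increasing_approx A u (m : R) :
  (forall x, A x -> m <= u x) -> lsc_on A u ->
  exists c : nat -> K -> R,
    [/\ c 0%N = cst m,
        forall n, continuous (c n),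
        forall x, {homo c ^~ x : i j / (i <= j)%N >-> i <= j},
        forall n x, A x -> c n x <= u x &
        forall x, A x -> c n x @[n --> \oo] --> u x].
Proof.
move=> um lu; have [->|/set0P[x0 Ax0]] := eqVneq A set0.
  exists (fun=> cst m); split => // [n x|x i j _]; [exact: cvg_cst|exact: lexx].
pose S n x := [set u y + n%:R * mdist x y | y in A].
have S0 n x : S n x !=set0 by exists (u x0 + n%:R * mdist x x0), x0.
have Sm n x : lbound (S n x) m.
  move=> _ [y Ay <-]; apply: le_trans (um y Ay) _.
  by rewrite lerDl mulr_ge0// mdist_ge0.
pose c n x := inf (S n x).
have c_le n x y : A y -> c n x <= u y + n%:R * mdist x y.
  by move=> Ay; apply: ge_inf; [exists m|exists y].
have c_ge n x : m <= c n x by apply: lb_le_inf.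
have cS n x : c n x <= c n.+1 x.
  apply: lb_le_inf => // _ [y Ay <-]; apply: le_trans (c_le n x y Ay) _.
  by rewrite lerD2l ler_wpM2r ?mdist_ge0// ler_nat.
have c_lip n x y : c n x <= c n y + n%:R * mdist x y.
  rewrite -lerBlDr; apply: lb_le_inf => // _ [z Az <-].
  rewrite lerBlDr; apply: le_trans (c_le n x z Az) _.
  by rewrite -addrA lerD2l -mulrDr ler_wpM2l// addrC metric_triangle.
have cc n : continuous (c n).
  move=> x; apply/cvgrPdist_lt => e e0.
  have d0 : 0 < e / n.+1%:R by rewrite divr_gt0.
  near=> y.
  have xy : mdist x y < e / n.+1%:R.
    near: y; have := nbhsx_ballx x _ d0; by rewrite ballEmdist.
  have nxy : n%:R * mdist x y < e.
    rewrite ltr_pdivlMr// in xy.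
    apply: le_lt_trans xy; rewrite mulrC ler_wpM2l ?mdist_ge0// ler_nat//.
  have := c_lip n x y; have := c_lip n y x; rewrite (metric_sym y x).
  by rewrite ltr_norml => ? ?; lra.
have c_u n x : A x -> c n x <= u x.
  by move=> Ax; have := c_le n x x Ax; rewrite mdistxx mulr0 addr0.
have chomo x : {homo c ^~ x : i j / (i <= j)%N >-> i <= j}.
  by apply/nondecreasing_seqP => n; exact: cS.
(* The shift makes the sequence start at the constant [m], still below all later terms by [c_ge]. *)
exists (fun n => if n is n'.+1 then c n' else cst m); split => //.
- by move=> [|n]; [move=> x; exact: cvg_cst|exact: cc].
- by move=> x [|i] [|j]//= ij; exact: chomo.
- by move=> [|n] x Ax /=; [exact: um|exact: c_u].
move=> x Ax; rewrite -cvg_shiftS /=; apply/cvgrPdist_lt => e e0.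
have e2 : 0 < e / 2 by rewrite divr_gt0.
have /nbhs_ballP[d /= d0] := lu x Ax _ e2; rewrite ballEmdist => dP.
(* Points within [d] of [x] are controlled by semicontinuity; farther ones pay at least [n%:R * d],
   which outweighs the drop to [m]. *)
near=> n.
have nd : u x - e / 2 - m < n%:R * d.
  rewrite -ltr_pdivrMr//; near: n; exact: nbhs_infty_gtr.
rewrite ger0_norm ?subr_ge0 ?c_u// ltrBlDr -ltrBlDl.
apply: (@lt_le_trans _ _ (u x - e / 2)); first by lra.
apply: lb_le_inf => // _ [y Ay <-].
have [xy|xy] := ltP (mdist x y) d.
  have uy := dP y xy; apply: (le_trans (ltW uy)).
  by rewrite lerDl mulr_ge0// mdist_ge0.
have := um y Ay; have : n%:R * d <= n%:R * mdist x y by exact: ler_wpM2l.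
by lra.
Unshelve. all: by end_near. Qed.

(* Hahn's insertion: if a n decreases to p and c n increases to q, then
   sup_n min (a n) (c n) = inf_n max (a n.+1) (c n), which is thus both lower
   and upper semicontinuous. *)
Lemma continuous_insertion A p q (M : R) : open A ->
  (forall x, A x -> [/\ - M <= p x, p x <= q x & q x <= M]) ->
  lsc_on A (fun x => - p x) -> lsc_on A q ->
  exists phi, (forall x, A x -> {for x, continuous phi}) /\
    (forall x, A x -> p x <= phi x <= q x).
Proof.
move=> oA pqM lp lq.
have [|c [c0 cc chomo c_le c_cvg]] := @lsc_increasing_approx A q (- M) _ lq.
  by move=> x /pqM[? ? ?]; lra.
(* The decreasing sequence is [- d n]. Its start [M + 1] lies strictly above [c 0 = - M], so the two
   sequences cannot cross at index 0. *)
have [|d [d0 dc dhomo d_le d_cvg]] :=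
  @lsc_increasing_approx A (fun x => - p x) (- (M + 1)) _ lp.
  by move=> x /pqM[? ? ?]; lra.
have {}c0 x : c 0%N x = - M by rewrite c0.
have {}d0 x : d 0%N x = - (M + 1) by rewrite d0.
pose F n x : R := Num.min (- d n x) (c n x).
pose phi x := sup (range (F ^~ x)).
have Fc n x : F n x <= c n x by rewrite /F ge_min lexx orbT.
have Fd n x : F n x <= - d n x by rewrite /F ge_min lexx.
have ubF x : A x -> ubound (range (F ^~ x)) (q x).
  by move=> Ax _ [n _ <-]; exact: le_trans (Fc n x) (c_le n x Ax).
have F0 x : range (F ^~ x) !=set0 by exists (F 0%N x), 0%N.
have F_phi n x : A x -> F n x <= phi x.
  by move=> Ax; apply: ub_le_sup; [exists (q x); exact: ubF|exists n].
have phi_q x : A x -> phi x <= q x by move=> Ax; apply: ge_sup => //; exact: ubF.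
have p_phi x : A x -> p x <= phi x.
  move=> Ax; apply/ler_addgt0Pr => e e0.
  have /(cvgr_gt (q x))/(_ (q x - e))[] := c_cvg x Ax; first by rewrite ltrBlDr ltrDl.
  move=> n _ /(_ n (leqnn n)) /= cn.
  rewrite -lerBlDr; apply: le_trans (F_phi n x Ax).
  rewrite /F le_min; have := d_le n x Ax; have [_ pq _] := pqM x Ax.
  by move=> dn; apply/andP; split; lra.
have phi_le n x : phi x <= Num.max (- d n.+1 x) (c n x).
  apply: ge_sup => // _ [k _ <-]; rewrite le_max.
  have [kn|nk] := leqP k n.
    by apply/orP; right; exact: le_trans (Fc k x) (chomo x _ _ kn).
  by apply/orP; left; apply: le_trans (Fd k x) _; rewrite lerN2; exact: dhomo.
have phi_ge x (e : R) : A x -> 0 < e ->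
    exists n, Num.max (- d n.+1 x) (c n x) < phi x + e.
  move=> Ax e0; have [Mp pq qM] := pqM x Ax.
  (* At the first crossing [k.+1], [F k] equals [c k] and [F k.+1] equals [- d k.+1], so [phi]
     dominates both. Without a crossing [F n] is always [c n], whence [phi] is at least [q], and
     [- d n] tends to [p]. *)
  have [exn|] := pselect (exists n, - d n x <= c n x).
    case: (ex_minnP exn) => -[|k]; first by rewrite c0 d0 => ?; exfalso; lra.
    move=> dck /(_ k); rewrite ltnn => /contraFN dk; exists k.
    have {}dk : c k x < - d k x by rewrite ltNge; exact: dk.
    have := F_phi k x Ax; rewrite /F (min_idPr (ltW dk)).
    have := F_phi k.+1 x Ax; rewrite /F (min_idPl dck) => ? ?.
    by rewrite gt_max; apply/andP; split; lra.
  move=> /forallNP nex.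
  have c_phi n : c n x <= phi x.
    have := F_phi n x Ax; rewrite /F min_r//.
    by have /negP := nex n; rewrite -ltNge => /ltW.
  have q_phi : q x <= phi x.
    by apply: cvgr_to_le (c_cvg x Ax) _; exact: nearW.
  have /(cvgr_gt (- p x))/(_ (- p x - e))[] := d_cvg x Ax.
    by rewrite ltrBlDr ltrDl.
  move=> n _ /(_ n (leqnn n)) /= dn; exists n.
  have := c_phi n; have := dhomo x n n.+1 (leqnSn n).
  by rewrite gt_max => ? ?; apply/andP; split; lra.
exists phi; split => [x Ax|x Ax]; last by rewrite p_phi ?phi_q.
apply/cvgrPdist_lt => e e0.
(* At these [n] and [k], continuous functions bound [phi] from above and below within [e] of
   [phi x]; the strict inequalities persist near [x]. *)
have [n nP] := phi_ge x e Ax e0.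
have [_ [k _ <-] kP] := sup_adherent e0 (conj (F0 x) (ex_intro _ _ (ubF x Ax))).
rewrite -/(phi x) in kP.
move: nP kP; rewrite gt_max lt_min => /andP[dn cn] /andP[dk ck].
near=> y.
have Ay : A y by near: y; exact: open_nbhs_nbhs.
have dn' : - d n.+1 y < phi x + e.
  by near: y; apply: cvgr_lt dn; apply: cvgN; exact: dc.
have cn' : c n y < phi x + e by near: y; apply: cvgr_lt cn; exact: cc.
have dk' : phi x - e < - d k y.
  by near: y; apply: cvgr_gt dk; apply: cvgN; exact: dc.
have ck' : phi x - e < c k y by near: y; apply: cvgr_gt ck; exact: cc.
have hi : phi y < phi x + e by rewrite (le_lt_trans (phi_le n y))// gt_max dn'.
have lo : phi x - e < phi y.
  by apply: lt_le_trans (F_phi k y Ay); rewrite lt_min dk'.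
by rewrite ltr_norml; apply/andP; split; lra.
Unshelve. all: by end_near. Qed.

End semicontinuity.

(** * The complex modulus and convergence *)

Section complex_norm.
Context {R : realType}.
Implicit Types (z w : R[i]) (r : R).

Lemma complex_normE z : `|z| = (normc z)%:C.
Proof. by []. Qed.

Lemma normc_real r : normc r%:C = `|r|.
Proof. by rewrite /= expr0n addr0 sqrtr_sqr. Qed.

Lemma normc_subC z w : normc (z - w) = normc (w - z).
Proof. by apply: complexI; rewrite -!complex_normE distrC. Qed.

Lemma normc_triangle z w : normc (z + w) <= normc z + normc w.
Proof. exact: le_normcD. Qed.

Lemma normc_sum_le (a : nat -> R[i]) m n :
  normc (\sum_(m <= j < n) a j) <= \sum_(m <= j < n) normc (a j).
Proof.
by apply: (big_ind2 (fun z r => normc z <= r)) => [|z r w s zr ws|//];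
  [rewrite normc0|exact: le_trans (normc_triangle z w) (lerD zr ws)].
Qed.

(** A positive [e] in [R[i]] has zero imaginary part, so real tolerances suffice. *)
Lemma cvg_normcP {T : Type} {F : set_system T} {FF : Filter F}
    (h : T -> R[i]) z :
  (h : T -> R[i]^o) @ F --> (z : R[i]^o) <->
  forall e, 0 < e -> \forall t \near F, normc (z - h t) < e.
Proof.
split => [/cvgrPdist_lt hz e e0|hz].
  have e0' : 0 < e%:C by rewrite ltcR.
  by apply: filterS (hz _ e0') => t; rewrite complex_normE ltcR.
apply/cvgrPdist_lt => e; rewrite ltcE => /andP[/eqP/= Im0 Re0].
by apply: filterS (hz _ Re0) => t; rewrite complex_normE ltcE /= Im0 eqxx.
Qed.

Lemma cvg_real_complex {T : Type} {F : set_system T} {FF : Filter F}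
    (h : T -> R) r :
  h @ F --> r -> (fun t => (h t)%:C : R[i]^o) @ F --> (r%:C : R[i]^o).
Proof.
move=> /cvgrPdist_lt hr; apply/(cvg_normcP (fun t => (h t)%:C)) => e /hr.
by apply: filterS => t; rewrite -rmorphB normc_real.
Qed.

End complex_norm.

(** * The lower bound for the quotient norm *)

Section D_norm_bounds.
Context {R : realType} {K : metricType R}.
Implicit Types (A : set K) (f phi : K -> R[i]) (x y : K).
Local Open Scope ereal_scope.

Lemma sup_sum_norm_ge0 A (phi : nat -> K -> R[i]) : 0 <= sup_sum_norm A phi.
Proof. by rewrite /sup_sum_norm le_max lexx. Qed.

Lemma qD_norm_ge0 A f : 0 <= qD_norm A f.
Proof.
apply: le_ereal_inf_tmp => _ [phi _ <-]; apply: le_ereal_inf_tmp => _ [psi _ <-].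
exact: sup_sum_norm_ge0.
Qed.

(** [S] is the full sum of the moduli at [x]; the remainder of the series for [f x] is bounded by
    the remainder of the moduli. *)
Lemma D_representation_tail A f (phi : nat -> K -> R[i]) x :
  D_representation A f phi -> A x ->
  exists2 S : R,
    [/\ S%:E <= sup_sum_norm A phi,
        forall N, (\sum_(0 <= j < N) normc (phi j x) <= S)%R &
        forall e : R, (0 < e)%R -> exists N,
          (S - e < \sum_(0 <= j < N) normc (phi j x))%R] &
    forall N, (normc (f x - \sum_(0 <= j < N) phi j x) <=
      S - \sum_(0 <= j < N) normc (phi j x))%R.
Proof.
move=> [_ supfin cvgf] Ax.
pose T N := (\sum_(0 <= j < N) normc (phi j x))%R.
have nd : nondecreasing_seq T.
  by apply/nondecreasing_seqP => n; rewrite /T big_nat_recr//= lerDl normc_ge0.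
set s := (\sum_(0 <= j <oo) (normc (phi j x))%:E).
have s_le : s <= sup_sum_norm A phi.
  by rewrite /sup_sum_norm le_max ereal_sup_ubound ?orbT//; exists x.
have T_s N : (T N)%:E <= s.
  rewrite /T -sumEFin; apply: nneseries_lim_ge => j _ _.
  by rewrite lee_fin normc_ge0.
have s_fin : s \is a fin_num.
  rewrite ge0_fin_numE ?(le_lt_trans s_le)//.
  by apply: le_trans (T_s 0%N); rewrite /T big_geq.
pose S := fine s.
have sE : s = S%:E by rewrite fineK.
have T_S N : (T N <= S)%R by rewrite -lee_fin -sE.
have S_adh (e : R) : (0 < e)%R -> exists N, (S - e < T N)%R.
  move=> e0; apply: contrapT => /forallNP nT.
  suff : s <= (S - e)%:E by rewrite sE lee_fin; lra.
  apply: lime_le; first by apply: is_cvg_nneseries => j _ _; rewrite lee_fin normc_ge0.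
  apply: nearW => n; rewrite sumEFin lee_fin -/(T n).
  by rewrite leNgt; exact/negP/nT.
exists S; first by rewrite -sE.
move=> N; rewrite -/(T N); apply/ler_addgt0Pr => e e0.
have [n Nn fn] : exists2 n, (N <= n)%N & (normc (f x - \sum_(0 <= j < n) phi j x) < e)%R.
  have := (cvg_normcP (series (phi ^~ x)) (f x)).1 (cvgf x Ax) e e0.
  move=> [n0 _ /= n0P]; exists (maxn N n0); first exact: leq_maxl.
  exact: (n0P _ (leq_maxr _ _)).
have -> : (f x - \sum_(0 <= j < N) phi j x =
    (f x - \sum_(0 <= j < n) phi j x) + \sum_(N <= j < n) phi j x)%R.
  by rewrite [X in (_ = _ - X + _)%R](@big_cat_nat _ _ _ N)//=; ring.
have := normc_sum_le (phi ^~ x) N n.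
have := normc_triangle (f x - \sum_(0 <= j < n) phi j x)%R (\sum_(N <= j < n) phi j x)%R.
have : (T n = T N + \sum_(N <= j < n) normc (phi j x))%R.
  by rewrite /T (@big_cat_nat _ _ _ N)//=.
have := T_S n.
by move=> ? ? ? ?; lra.
Qed.

(* If the |psi_j| represent f - phi on A with sums at most M, then
   M - sum_j |psi_j|, extended by +oo outside A, is a possible h. *)
Lemma least_supersolution_le_qD_norm (g : K -> \bar R) f A : open A ->
  (forall h, (forall x, 0 <= h x) ->
     (forall x, osc_tilde_succ f h x <= h x) -> forall x, g x <= h x) ->
  forall x, A x -> g x <= qD_norm A f.
Proof.
move=> oA gmin x0 Ax0.
apply: le_ereal_inf_tmp => _ [phi [+ _] <-].
rewrite continuous_open_subspace// => cphi.
apply: le_ereal_inf_tmp => _ [psi rep <-].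
have [+ M_fin _] := rep; move=> cpsi.
have {}cpsi j : {in A, continuous (psi j : K -> R[i]^o)}.
  by have := cpsi j; rewrite continuous_open_subspace.
have [M ME] : exists M : R, sup_sum_norm A psi = M%:E.
  exists (fine (sup_sum_norm A psi)); rewrite fineK// ge0_fin_numE//.
  exact: sup_sum_norm_ge0.
have /choice[S SP] : forall x, exists S : R, A x ->
    [/\ (S <= M)%R, forall N, (\sum_(0 <= j < N) normc (psi j x) <= S)%R,
        forall e : R, (0 < e)%R -> exists N,
          (S - e < \sum_(0 <= j < N) normc (psi j x))%R &
        forall N, (normc (f x - phi x - \sum_(0 <= j < N) psi j x) <=
          S - \sum_(0 <= j < N) normc (psi j x))%R].
  move=> x; have [Ax|nAx] := pselect (A x); last by exists 0%R.
  have [S [SM S1 S2] S3] := D_representation_tail rep Ax.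
  by exists S; split => //; rewrite -lee_fin -ME.
pose h x := if `[< A x >] then (M - S x)%:E else +oo.
have hE x : A x -> h x = (M - S x)%:E by move=> Ax; rewrite /h; case: asboolP.
suff : g x0 <= h x0.
  rewrite hE// ME => /le_trans; apply; rewrite lee_fin.
  have [_ /(_ 0%N) + _ _] := SP x0 Ax0; rewrite big_geq//; lra.
apply: gmin => x; rewrite {hE}/h.
  case: asboolP => // Ax; have [SM _ _ _] := SP x Ax.
  by rewrite lee_fin subr_ge0.
case: asboolP => [Ax|_]; last exact: leey.
apply/lee_addgt0Pr => e e0; apply: limf_esup_le.
(* Five errors: the change of [phi], the change of the partial sums of [psi], that of their absolute
   sums, and twice the tail at [x]. The tail at [y] may be large, but the [- S y] in [h y] absorbs
   it. *)
have e5 : (0 < e / 5)%R by rewrite divr_gt0.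
have [_ T_x /(_ _ e5)[N TN] tail_x] := SP x Ax.
have phi_x : \forall y \near x, (normc (phi x - phi y) < e / 5)%R.
  apply: (cvg_normcP phi (phi x)).1 e5.
  by apply: cphi; exact/mem_set.
have psi_x n (d : R) : (0 < d)%R ->
    \forall y \near x, (\sum_(0 <= j < n) normc (psi j x - psi j y) < d)%R.
  elim: n d => [|n IH] d d0; first by apply: nearW => y; rewrite big_geq.
  have d2 : (0 < d / 2)%R by rewrite divr_gt0.
  have psin : \forall y \near x, (normc (psi n x - psi n y) < d / 2)%R.
    apply: (cvg_normcP (psi n) (psi n x)).1 d2.
    by apply: cpsi; exact/mem_set.
  apply: filterS2 (IH _ d2) psin => y y1 y2.
  by rewrite big_nat_recr//=; lra.
near=> y.
have Ay : A y by near: y; exact: open_nbhs_nbhs.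
have phi_y : (normc (phi x - phi y) < e / 5)%R by near: y.
have psi_y : (\sum_(0 <= j < N) normc (psi j x - psi j y) < e / 5)%R.
  by near: y; exact: psi_x.
have [_ _ _ tail_y] := SP y Ay.
case: asboolP => // _; rewrite -!EFinD lee_fin.
have := tail_x N; have := tail_y N.
set Tx := (\sum_(0 <= j < N) normc (psi j x))%R in TN *.
set Ty := (\sum_(0 <= j < N) normc (psi j y))%R.
set sx := (\sum_(0 <= j < N) psi j x)%R; set sy := (\sum_(0 <= j < N) psi j y)%R.
have Txy : (Tx - Ty <= \sum_(0 <= j < N) normc (psi j x - psi j y))%R.
  rewrite -sumrB; apply: ler_sum => j _.
  have := normc_triangle (psi j x - psi j y)%R (psi j y); rewrite subrK; lra.
have sxy : (normc (sx - sy) <= \sum_(0 <= j < N) normc (psi j x - psi j y))%R.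
  by rewrite -sumrB; exact: normc_sum_le.
have := normc_triangle (f y - phi y - sy)%R (phi y + sy - f x)%R.
rewrite (_ : f y - phi y - sy + (phi y + sy - f x) = f y - f x)%R; last by ring.
have := normc_triangle (phi y - phi x)%R (phi x + sy - f x)%R.
rewrite (_ : phi y - phi x + (phi x + sy - f x) = phi y + sy - f x)%R; last by ring.
have := normc_triangle (sy - sx)%R (phi x + sx - f x)%R.
rewrite (_ : sy - sx + (phi x + sx - f x) = phi x + sy - f x)%R; last by ring.
rewrite (normc_subC (phi y)) (normc_subC sy) (normc_subC (phi x + sx)%R).
rewrite (_ : f x - (phi x + sx) = f x - phi x - sx)%R; last by ring.
by move: psi_y phi_y TN Txy sxy; lra.
Unshelve. all: by end_near. Qed.

End D_norm_bounds.

(** * The upper bound and its attainment *)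

Section D_norm_upper.
Context {R : realType} {K : metricType R}.
Implicit Types (A : set K) (x y : K).

(* Writing w as the difference of (s + w) / 2 and (s - w) / 2, each a sum of
   nonnegative continuous functions, represents w with absolute sums at most
   s. *)
Lemma D_norm_le_of_lsc A (w s : K -> R) (lam : R) : 0 <= lam ->
  (forall x, A x -> `|w x| <= s x <= lam) ->
  lsc_on A (fun x => s x + w x) -> lsc_on A (fun x => s x - w x) ->
  (D_norm A (fun x => (w x)%:C) <= lam%:E)%E.
Proof.
move=> lam0 ws l1 l2; have h0 : 0 < 2^-1 :> R by rewrite invr_gt0.
have [|b [b0 cb bhomo b_le b_cvg]] :=
  @lsc_increasing_approx R K A (fun x => 2^-1 * (s x + w x)) 0 _ (lsc_on_scale h0 l1).
  by move=> x /ws /andP[]; rewrite ler_norml => /andP[]; lra.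
have [|d [d0 cd dhomo d_le d_cvg]] :=
  @lsc_increasing_approx R K A (fun x => 2^-1 * (s x - w x)) 0 _ (lsc_on_scale h0 l2).
  by move=> x /ws /andP[]; rewrite ler_norml => /andP[]; lra.
have {}b0 x : b 0%N x = 0 by rewrite b0.
have {}d0 x : d 0%N x = 0 by rewrite d0.
(* Increments of [b] and [d] are nonnegative, so the moduli are at most their sum, which telescopes
   to [b n + d n] and stays below [s]. *)
pose phi j x := ((b j.+1 x - b j x) - (d j.+1 x - d j x))%:C.
have sum_phi n x : \sum_(0 <= j < n) phi j x = (b n x - d n x)%:C.
  rewrite /phi -rmorph_sum/= sumrB !telescope_sumr//.
  by rewrite b0 d0 !subr0.
have sum_normc n x : \sum_(0 <= j < n) normc (phi j x) <= b n x + d n x.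
  apply: (@le_trans _ _ (\sum_(0 <= j < n) ((b j.+1 x - b j x) + (d j.+1 x - d j x)))).
    apply: ler_sum => j _; rewrite normc_real.
    have := bhomo x j j.+1 (leqnSn j); have := dhomo x j j.+1 (leqnSn j).
    by rewrite ler_norml => ? ?; apply/andP; split; lra.
  by rewrite big_split/= !telescope_sumr// b0 d0 !subr0.
have phi_lam : (sup_sum_norm A phi <= lam%:E)%E.
  rewrite /sup_sum_norm ge_max lee_fin lam0 andTb; apply: ub_ereal_sup => _ [x Ax <-].
  apply: lime_le; first by apply: is_cvg_nneseries => j _ _; rewrite lee_fin normc_ge0.
  apply: nearW => n; rewrite sumEFin lee_fin; apply: le_trans (sum_normc n x) _.
  have := b_le n x Ax; have := d_le n x Ax; have /andP[_] := ws x Ax; lra.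
apply: (le_trans _ phi_lam); apply: ereal_inf_lbound; exists phi => //; split.
- move=> j; apply: continuous_subspaceT => x; apply: cvg_real_complex.
  by apply: cvgB; apply: cvgB; [exact: cb|exact: cb|exact: cd|exact: cd].
- exact: le_lt_trans phi_lam (ltry _).
- move=> x Ax.
  have -> : series (phi ^~ x) = (fun n => (b n x - d n x)%:C).
    by apply/funext => n; exact: sum_phi.
  apply: cvg_real_complex.
  rewrite (_ : w x = 2^-1 * (s x + w x) - 2^-1 * (s x - w x)); last by field.
  exact: cvgB (b_cvg x Ax) (d_cvg x Ax).
Qed.

Lemma qD_norm_attained_le (g : K -> \bar R) (f : K -> R) A (lam : R) : open A ->
  bounded_fun f -> 0 <= lam -> (forall x, (0 <= g x)%E) ->
  (forall x, (osc_tilde_succ (fun x => (f x)%:C) g x <= g x)%E) ->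
  (forall x, A x -> (g x <= lam%:E)%E) ->
  exists2 phi : K -> R[i], C_b A phi &
    (D_norm A ((fun x => (f x)%:C) \- phi)%R <= lam%:E)%E.
Proof.
move=> oA /ex_strict_bound_gt0[B B0 fB] lam0 g0 gP g_lam.
have {}fB x : `|f x| < B := fB x I.
pose s x := lam - fine (g x).
have gE x : A x -> g x = (fine (g x))%:E.
  move=> Ax; rewrite fineK// ge0_fin_numE//; exact: le_lt_trans (g_lam x Ax) (ltry _).
have s0 x : A x -> 0 <= s x <= lam.
  move=> Ax; have := g_lam x Ax; have := g0 x; rewrite (gE x Ax) !lee_fin /s.
  by move=> ? ?; apply/andP; split; lra.
(* The inequality for [g], rewritten for [s], bounds both signs of [f y - f x], so it gives
   semicontinuity of [s + f] and of [s - f] at once. *)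
have s_near x (e : R) : A x -> 0 < e ->
    \forall y \near x, `|f y - f x| + s x < s y + e.
  move=> Ax e0; have : (osc_tilde_succ (fun x => (f x)%:C) g x < g x + e%:E)%E.
    by apply: le_lt_trans (gP x) _; rewrite (gE x Ax) -EFinD lte_fin ltrDl.
  move=> /limf_esup_lt nearx.
  near=> y; have Ay : A y by near: y; exact: open_nbhs_nbhs.
  have : ((normc ((f y)%:C - (f x)%:C))%:E + g y < g x + e%:E)%E by near: y.
  by rewrite -rmorphB normc_real (gE x Ax) (gE y Ay) -!EFinD lte_fin /s; lra.
have lsDf : lsc_on A (fun x => s x + f x).
  move=> x Ax e e0; apply: filterS (s_near x e Ax e0) => y.
  by have := ler_norm (f x - f y); rewrite distrC; lra.
have lsBf : lsc_on A (fun x => s x - f x).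
  move=> x Ax e e0; apply: filterS (s_near x e Ax e0) => y.
  by have := ler_norm (f y - f x); lra.
have [| | |phi [cphi phiP]] :=
    @continuous_insertion R K A (fun x => f x - s x) (fun x => s x + f x) (B + lam) oA.
- move=> x Ax; have /andP[? ?] := s0 x Ax.
  have := fB x; rewrite ltr_norml => /andP[? ?]; split; lra.
- by move=> x Ax e e0; apply: filterS (lsBf x Ax e e0) => y; lra.
- exact: lsDf.
exists (fun x => (phi x)%:C); first split.
- rewrite continuous_open_subspace// => x /set_mem Ax.
  by apply: cvg_real_complex; exact: cphi.
- exists ((B + 2 * lam)%:C); split; first by rewrite complex_real.
  move=> r lr x Ax /=; rewrite complex_normE normc_real.
  apply: le_trans (ltW lr); rewrite lecR.
  have /andP[? ?] := s0 x Ax; have /andP[? ?] := phiP x Ax.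
  have := fB x; rewrite ltr_norml => /andP[? ?].
  by rewrite ler_norml; apply/andP; split; lra.
have -> : ((fun x => (f x)%:C) \- (fun x => (phi x)%:C)) = (fun x => (f x - phi x)%:C).
  by apply/funext => x; rewrite rmorphB.
apply: (@D_norm_le_of_lsc A (fun x => f x - phi x) s) => //.
- move=> x Ax; have /andP[? ?] := s0 x Ax; have /andP[? ?] := phiP x Ax.
  by rewrite ler_norml; apply/andP; split; [apply/andP; split|]; lra.
- rewrite (_ : (fun x => _) = (fun x => (s x + f x) + - phi x)); last first.
    by apply/funext => x; rewrite addrA.
  by apply: lsc_on_addr_continuous => // x Ax; apply: cvgN; exact: cphi.
- rewrite (_ : (fun x => _) = (fun x => (s x - f x) + phi x)); last first.
    by apply/funext => x; rewrite opprB addrA addrAC.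
  exact: lsc_on_addr_continuous.
Unshelve. all: by end_near. Qed.

(** With [f = p1 - p2] and [h = B1 + B2 - p1 - p2], the functions [h + f] and [h - f] are constants
    minus [2 * p2] and [2 * p1], hence upper semicontinuous. This [h] will bound the oscillation. *)
Lemma in_D_supersolution (f : K -> R) : in_D (fun x => (f x)%:C) ->
  exists h : K -> R, [/\ forall x, 0 <= h x, bounded_fun h &
    forall x, (osc_tilde_succ (fun x => (f x)%:C) (EFin \o h) x <= (h x)%:E)%E].
Proof.
move=> [p1 [p2 [p3 [p4 [[bp1 bp2 _ _] [lp1 lp2 _ _] fE]]]]].
have fp x : f x = p1 x - p2 x.
  by have := congr1 (@complex.Re R) (fE x); rewrite /= !mul0r !mul1r; lra.
have [B1 B1_0 p1B] := ex_strict_bound_gt0 bp1.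
have [B2 B2_0 p2B] := ex_strict_bound_gt0 bp2.
have {}p1B x : `|p1 x| < B1 := p1B x I.
have {}p2B x : `|p2 x| < B2 := p2B x I.
exists (fun x => B1 + B2 - p1 x - p2 x); split => [x||x].
- have := p1B x; have := p2B x; rewrite !ltr_norml => /andP[? ?] /andP[? ?]; lra.
- exists (2 * (B1 + B2)); split; first exact: num_real.
  move=> r lr x _ /=; have := p1B x; have := p2B x.
  by rewrite !ltr_norml ler_norml => /andP[? ?] /andP[? ?]; apply/andP; split; lra.
apply/lee_addgt0Pr => e e0; apply: limf_esup_le.
have e2 : 0 < e / 2 by rewrite divr_gt0.
have [|V1 nV1 V1P] := lp1 x (p1 x - e / 2); first by rewrite lte_fin ltrBlDr ltrDl.
have [|V2 nV2 V2P] := lp2 x (p2 x - e / 2); first by rewrite lte_fin ltrBlDr ltrDl.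
apply: filterS2 nV1 nV2 => y /V1P + /V2P; rewrite !lte_fin => y1 y2.
rewrite -rmorphB normc_real -!EFinD lee_fin !fp.
by case: ler0P => _; lra.
Qed.

End D_norm_upper.

Theorem corollary3p5 (R : realType) (K : metricType R) (f : K -> R)
    (bounded_f : bounded_fun f) :
  let fC : K -> R[i] := fun x => (f x)%:C in
  let alpha := D_index fC in
  (forall x : K, osc fC alpha x = qD_norm_at fC x) /\
  (in_D fC ->
     exists2 phi : K -> R[i], C_b setT phi &
       qD_norm setT fC = D_norm setT (fC \- phi)).
Proof.
move=> fC alpha; have [] := osc_D_index fC; rewrite -/alpha.
set g := osc fC alpha => g0 gP gmin; split => [x|/in_D_supersolution[h [h0 bh hP]]].
  apply/eqP; rewrite eq_le; apply/andP; split.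
    apply: le_ereal_inf_tmp => _ [U [oU Ux] <-].
    exact: least_supersolution_le_qD_norm gmin _ Ux.
  have [->|gx_fin] := eqVneq (g x) +oo%E; first exact: leey.
  have gE : g x = (fine (g x))%:E by rewrite fineK// ge0_fin_numE// ltey.
  apply/lee_addgt0Pr => e e0; pose lam := fine (g x) + e.
  have lam0 : 0 <= lam by rewrite addr_ge0 ?fine_ge0// ltW.
  have gx_lam : (osc_tilde_succ fC g x < lam%:E)%E.
    by apply: le_lt_trans (gP x) _; rewrite gE lte_fin ltrDl.
  (* Since the limsup at [x] is below [lam], the sublevel set of [g] is a neighborhood of [x]; its
     interior is the open set required. *)
  have [V [oV Vx] Vlam] : exists2 V, open V /\ V x & forall y, V y -> (g y <= lam%:E)%E.
    exists [set y | (g y <= lam%:E)%E]^°; last by move=> y /interior_subset.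
    split; [exact: open_interior|apply: filterS (limf_esup_lt gx_lam) => y].
    by move=> /ltW; apply: le_trans; rewrite leeDr// lee_fin normc_ge0.
  have [phi Cphi phi_lam] := qD_norm_attained_le oV bounded_f lam0 g0 gP Vlam.
  rewrite gE -EFinD; apply: le_trans phi_lam.
  apply: (@le_trans _ _ (qD_norm V fC)); apply: ereal_inf_lbound; first by exists V.
  by exists phi.
have [B B0 hB] := ex_strict_bound_gt0 bh.
have gh x : (g x <= (h x)%:E)%E by apply: (gmin (EFin \o h)) => // y; rewrite lee_fin.
(* The maximum with 0 covers an empty [K]. *)
pose L := maxe 0%E (ereal_sup (range g)).
have L0 : (0 <= L)%E by rewrite le_max lexx.
have gL x : (g x <= L)%E.
  by rewrite le_max ereal_sup_ubound ?orbT//; exists x.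
have LE : L = (fine L)%:E.
  rewrite fineK// ge0_fin_numE//; apply: le_lt_trans (ltry B).
  rewrite ge_max lee_fin (ltW B0)/=; apply: ub_ereal_sup => _ [x _ <-].
  apply: le_trans (gh x) _; rewrite lee_fin.
  exact: le_trans (ler_norm _) (ltW (hB x I)).
have gL' x : [set: K] x -> (g x <= (fine L)%:E)%E by rewrite -LE.
have [phi Cphi] := qD_norm_attained_le openT bounded_f (fine_ge0 L0) g0 gP gL'.
rewrite -LE => phiL; exists phi => //; apply/eqP; rewrite eq_le.
rewrite ereal_inf_lbound; last by exists phi.
(* The norm of [fC \- phi] is at most [L], and each value of [g] is a lower bound for
   [qD_norm setT fC]. *)
apply: le_trans phiL _; rewrite ge_max qD_norm_ge0/=.
apply: ub_ereal_sup => _ [x _ <-].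
exact: least_supersolution_le_qD_norm openT gmin _ I.
Qed.
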